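(* In the almost Kähler quantization, let $x\in M$ and let $0\ne q\in\ell_x$. Then for all $y\in M$ $$K^{(k)}(x,y)=\overline q^{\otimes k}\otimes e^{(k)}_q(y).$$ Equivalently, the symplectic coherent state $\Phi^{(k)}_x=K^{(k)}(x,\cdot)$ satisfies $\Phi^{(k)}_x=\overline q^{\otimes k}\otimes e^{(k)}_q$. Here $e^{(k)}_q\in\mathcal H_k$ is the Rawnsley-type coherent state.
   Context: Setting. $(M,\omega)$ is a compact symplectic manifold of dimension $2n$ with $[\omega/2\pi]$ integral; $\pi:\ell\to M$ is a Hermitian line bundle with compatible connection $\nabla$ of curvature $-i\omega$; $\ell^{\otimes k}$ carries the induced Hermitian structure $h$ (conjugate linear in the first argument) and connection. $\epsilon_\omega=(2\pi)^{-n}\omega^{\wedge n}/n!$ and $\langle s_1|s_2\rangle=\int_M h(s_1,s_2)\,\epsilon_\omega$. $J$ is an $\omega$-compatible almost complex structure, $g=\omega(\cdot,J\cdot)$, $TM^{(1,0)}$ is the $+i$-eigenbundle of $J$ in $TM_{\mathbb C}$, and $d_k=\int_M \mathrm{ch}(\ell^{\otimes k})\,\mathrm{Td}(TM^{(1,0)})$. Almost Kähler quantization: $\mathcal H_k$ is the span of orthonormal eigensections $\theta^{(k)}_1,\dots,\theta^{(k)}_{d_k}$ for the first $d_k$ eigenvalues (in nondecreasing order, with multiplicity) of $\Delta_k=\Delta-nk$, where $\Delta$ is the Laplacian on sections of $\ell^{\otimes k}$ for $g$ and $\nabla$; $k$ is large enough that, with constants $a>0$ and $C$ independent of $k$, the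 first $d_k$ eigenvalues lie in $(-a,a)$ and the others lie to the right of $nk+C$. Definitions. $K^{(k)}(x,y)=\sum_{j=1}^{d_k}\overline{\theta^{(k)}_j(x)}\otimes\theta^{(k)}_j(y)\in\overline{\ell^{\otimes k}_x}\otimes\ell^{\otimes k}_y$. For $0\ne q\in\ell_x$, let $\delta_q:\mathcal H_k\to\mathbb C$ be the continuous linear functional defined by $s(x)=\delta_q(s)\,q^{\otimes k}$; $e^{(k)}_q\in\mathcal H_k$ is the unique element (Riesz representation) with $\langle e^{(k)}_q|s\rangle=\delta_q(s)$ for all $s\in\mathcal H_k$, i.e. $\langle e^{(k)}_q|s\rangle\,q^{\otimes k}=s(\pi(q))$. *)

(* Defs.v *)
From HB Require Import structures.
From mathcomp Require Import all_boot all_order all_fingroup all_algebra.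
From mathcomp Require Import complex.
From mathcomp Require Import all_classical all_reals all_analysis.

Set Implicit Arguments.
Unset Strict Implicit.
Unset Printing Implicit Defensive.

Import Order.TTheory GRing.Theory Num.Theory.
Import numFieldNormedType.Exports.

Local Open Scope classical_set_scope.
Local Open Scope ring_scope.
Local Open Scope complex_scope.

Section Calculus.
Context {R : realType} {m : nat}.
Implicit Types (U : set 'rV[R]_m) (f : 'rV[R]_m -> R).

Fixpoint Cn (r : nat) U f : Prop :=
  (forall p, U p -> {for p, continuous f}) /\
  match r with
  | 0 => True
  | r'.+1 => forall a : 'I_m,
      (forall p, U p -> derivable f p (delta_mx 0 a)) /\
      Cn r' U (fun p => 'D_(delta_mx 0 a) f p)
  end.

Definition smooth U f : Prop := forall r, Cn r U f.

End Calculus.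

(* For nonnegative Borel functions this is, by Tonelli, the integral against
   Lebesgue measure on R^m. *)
Fixpoint rV_integral (R : realType) (m : nat) : ('rV[R]_m -> \bar R) -> \bar R :=
  match m return ('rV[R]_m -> \bar R) -> \bar R with
  | 0 => fun f => f 0
  | m'.+1 => fun f =>
      (\int[@lebesgue_measure R]_t
         @rV_integral R m' (fun v => f (row_mx (t%:M : 'rV[R]_1) v)))%E
  end.

Record manifold (R : realType) (m : nat) := Manifold {
  carrier :> ptopologicalType;
  chart : Type; (* index set of the atlas *)
  dom : chart -> set carrier;
  phi : chart -> carrier -> 'rV[R]_m;
  psi : chart -> 'rV[R]_m -> carrier;
  chart_at : carrier -> chart;
  chart_atP : forall x, dom (chart_at x) x;
  dom_open : forall i, open (dom i);
  phi_open : forall i, open (phi i @` dom i);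
  phiK : forall i x, dom i x -> psi i (phi i x) = x;
  phi_continuous : forall i x, dom i x -> {for x, continuous (phi i)};
  psi_continuous : forall i p, (phi i @` dom i) p -> {for p, continuous (psi i)};
  transition_smooth : forall i j b,
    smooth (phi i @` (dom i `&` dom j)) (fun p => phi j (psi i p) 0 b);
  carrier_hausdorff : hausdorff_space carrier;
  carrier_compact : compact [set: carrier]
}.
Arguments chart {R m} _.
Arguments dom {R m _}.
Arguments phi {R m _}.
Arguments psi {R m _}.
Arguments chart_at {R m _}.

Section Local.
Context {R : realType} {m : nat} {M : manifold R m}.
Local Notation C := R[i].

Definition smooth_on (i : chart M) (U : set M) (f : M -> R) : Prop :=
  smooth (phi i @` U) (f \o psi i).

Definition csmooth_on (i : chart M) (U : set M) (f : M -> C) : Prop :=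
  smooth_on i U ((@complex.Re R) \o f) /\ smooth_on i U ((@complex.Im R) \o f).

Definition pd (i : chart M) (a : 'I_m) (f : M -> R) (x : M) : R :=
  'D_(delta_mx 0 a) (f \o psi i) (phi i x).

Definition cpd (i : chart M) (a : 'I_m) (f : M -> C) (x : M) : C :=
  pd i a ((@complex.Re R) \o f) x +i* pd i a ((@complex.Im R) \o f) x.

Definition mpd (i : chart M) (a : 'I_m) (F : M -> 'M[R]_m) (x : M) : 'M[R]_m :=
  \matrix_(c, d) pd i a (fun z => F z c d) x.

(* (b, a) entry: derivative of the b-th coordinate of j along the a-th of i. *)
Definition jac (i j : chart M) (x : M) : 'M[R]_m :=
  \matrix_(b, a) pd i a (fun z => phi j z 0 b) x.

End Local.

(* Tensors are given by their components in each chart, together with their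
   transformation rule.  Tangent vectors are columns. *)

Record symplectic_form {R : realType} {m : nat} (M : manifold R m) :=
  SymplecticForm {
  omega : chart M -> M -> 'M[R]_m; (* omega i x a b = omega_x(d_a, d_b) *)
  omega_smooth : forall i a b, smooth_on i (dom i) (fun x => omega i x a b);
  omega_change : forall i j x, dom i x -> dom j x ->
    omega i x = (jac i j x)^T *m omega j x *m jac i j x;
  omega_antisym : forall i x, dom i x -> (omega i x)^T = - omega i x;
  omega_nondeg : forall i x, dom i x -> omega i x \in unitmx;
  omega_closed : forall i x a b c, dom i x ->
    pd i a (fun z => omega i z b c) x + pd i b (fun z => omega i z c a) x
    + pd i c (fun z => omega i z a b) x = 0
}.

Record compatible_acs {R : realType} {m : nat} {M : manifold R m}
    (w : symplectic_form M) := CompatibleAcs {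
  acs : chart M -> M -> 'M[R]_m;
  acs_smooth : forall i a b, smooth_on i (dom i) (fun x => acs i x a b);
  acs_change : forall i j x, dom i x -> dom j x ->
    jac i j x *m acs i x = acs j x *m jac i j x;
  acs_sqr : forall i x, dom i x -> acs i x *m acs i x = - 1%:M;
  acs_sym : forall i x, dom i x ->
    (omega w i x *m acs i x)^T = omega w i x *m acs i x;
  acs_pos : forall i x (v : 'cV[R]_m), dom i x -> v != 0 ->
    0 < (v^T *m (omega w i x *m acs i x) *m v) 0 0
}.

Definition metric {R : realType} {m : nat} {M : manifold R m}
    {w : symplectic_form M} (J : compatible_acs w) (i : chart M) (x : M) :
    'M[R]_m := omega w i x *m acs J i x.

(* The conjugate of V: same vectors, scalars act through conjugation. *)
Definition conj_space (R : realType) (V : vectType R[i]) : Type := V.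

Section ConjSpace.
Context (R : realType) (V : vectType R[i]).
Local Notation C := R[i].

HB.instance Definition _ := GRing.Zmodule.on (conj_space V).

Definition conj_scale (a : C) (v : conj_space V) : conj_space V :=
  (Num.conj a : C) *: (v : V).

Fact conj_scaleA a b v :
  conj_scale a (conj_scale b v) = conj_scale (a * b) v.
Proof. by rewrite /conj_scale scalerA rmorphM. Qed.

Fact conj_scale1 : left_id 1 conj_scale.
Proof. by move=> v; rewrite /conj_scale rmorph1 scale1r. Qed.

Fact conj_scaleDr : right_distributive conj_scale +%R.
Proof. by move=> a u v; rewrite /conj_scale scalerDr. Qed.

Fact conj_scaleDl v : {morph conj_scale^~ v : a b / a + b}.
Proof. by move=> a b; rewrite /conj_scale rmorphD scalerDl. Qed.

HB.instance Definition _ := GRing.Zmodule_isLmodule.Build C (conj_space V)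
  conj_scaleA conj_scale1 conj_scaleDr conj_scaleDl.

Import VectorInternalTheory.

Fact conj_space_vect : Vector.axiom (dim V) (conj_space V).
Proof.
pose cmx := map_mx (Num.conj : C -> C) : 'rV_(dim V) -> 'rV_(dim V).
have cmxK : involutive cmx by move=> r; apply/rowP=> j; rewrite !mxE conjCK.
exists (fun v => cmx (v2r (v : V))).
  move=> a u v; apply/rowP => j.
  have -> : v2r (a *: u + v : conj_space V) =
            Num.conj a *: v2r (u : V) + v2r (v : V).
    by rewrite -linearZ -linearD.
  by rewrite !mxE rmorphD rmorphM; congr (_ * _ + _); exact: conjCK.
exists (fun r => r2v (cmx r)) => [v|r]; first by rewrite cmxK; exact: v2rK.
by rewrite r2vK cmxK.
Qed.

HB.instance Definition _ :=
  Lmodule_hasFinDim.Build C (conj_space V) conj_space_vect.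

End ConjSpace.

Section Tensor.
Context {R : realType}.
Local Notation C := R[i].

(* For finite-dimensional spaces, V (x) W is Hom(V^*, W), the elementary tensor
   v (x) w being f |-> f(v) w. *)
Definition tens (V W : vectType C) : vectType C := 'Hom('Hom(V, C^o), W).

Definition tensor {V W : vectType C} (v : V) (w : W) : tens V W :=
  linfun (fun f : 'Hom(V, C^o) => (f v : C) *: w).

Fixpoint tpow (V : vectType C) (k : nat) : vectType C :=
  if k is k'.+1 then tens V (tpow V k') else C^o.

Fixpoint tpure {V : vectType C} (q : V) (k : nat) : tpow V k :=
  match k return tpow V k with
  | 0 => (1 : C^o)
  | k'.+1 => tensor q (tpure q k')
  end.

(* In a line with basis vector q: the c such that v = c q. *)
Definition coef {V : vectType C} (q v : V) : C := coord [tuple q] ord0 v.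

End Tensor.

(* Every line bundle over a manifold is trivial over the charts of some atlas;
   the smooth structure of the bundle is given by a frame over each chart. *)
Record hermitian_line_bundle {R : realType} {m : nat} (M : manifold R m) :=
  HermitianLineBundle {
  fiber : M -> vectType R[i];
  fiber_dim : forall x, \dim {: fiber x} = 1%N;
  frame : chart M -> forall x, fiber x;
  frame_neq0 : forall i x, dom i x -> frame i x != 0;
  frame_smooth : forall i j,
    csmooth_on i (dom i `&` dom j) (fun x => coef (frame i x) (frame j x));
  herm : forall x, fiber x -> fiber x -> R[i];
  herm_linear : forall x (u v w : fiber x) (c : R[i]),
    herm u (c *: v + w) = c * herm u v + herm u w;
  herm_sym : forall x (u v : fiber x), herm u v = Num.conj (herm v u);
  herm_pos : forall x (u : fiber x), u != 0 -> 0 < herm u u;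
  herm_smooth : forall i,
    csmooth_on i (dom i) (fun x => herm (frame i x) (frame i x))
}.

(* conn i x a is the number A_a with nabla_{d_a} e = A_a e, for e = frame i. *)
Record prequantum_connection {R : realType} {m : nat} {M : manifold R m}
    (L : hermitian_line_bundle M) (w : symplectic_form M) :=
  PrequantumConnection {
  conn : chart M -> M -> 'I_m -> R[i];
  conn_smooth : forall i a, csmooth_on i (dom i) (fun x => conn i x a);
  conn_change : forall i j x a, dom i x -> dom j x ->
    let t := fun z => coef (frame L i z) (frame L j z) in
    \sum_b (jac i j x b a)%:C * conn j x b = conn i x a + cpd i a t x / t x;
  conn_herm : forall i x a, dom i x ->
    cpd i a (fun z => herm (frame L i z) (frame L i z)) x =
    (Num.conj (conn i x a) + conn i x a) * herm (frame L i x) (frame L i x);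
  conn_curv : forall i x a b, dom i x ->
    cpd i a (fun z => conn i z b) x - cpd i b (fun z => conn i z a) x =
    - 'i * (omega w i x a b)%:C
}.

(* Elements of the exterior algebra on e_0, ..., e_(m-1): the value at
   S = {a1 < ... < ap} is the coefficient of e_a1 /\ ... /\ e_ap. *)

Section Exterior.
Context {K : fieldType} {m : nat}.

Definition ext : Type := {ffun {set 'I_m} -> K^o}.
HB.instance Definition _ := GRing.Lmodule.on ext.
Implicit Types (al be : ext) (X Y : 'M[ext]_m).

Definition inversions (S T : {set 'I_m}) : nat :=
  #|[set p : 'I_m * 'I_m | [&& p.1 \in S, p.2 \in T & (p.2 < p.1)%N]]|.

Definition wedge al be : ext :=
  [ffun S : {set 'I_m} => \sum_(T : {set 'I_m} | T \subset S)
     (-1) ^+ inversions T (S :\: T) * (al T : K) * (be (S :\: T) : K) : K^o].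

Definition ext_const (c : K) : ext :=
  [ffun S : {set 'I_m} => c *+ (S == finset.set0) : K^o].

Definition ext2 (B : 'I_m -> 'I_m -> K) : ext :=
  [ffun S : {set 'I_m} => \sum_(a < m) \sum_(b < m | (a < b)%N)
     B a b *+ (S == [set a; b]%SET) : K^o].

Definition top al : K := al finset.setT.

Definition wpow al (r : nat) : ext := iter r (wedge al) (ext_const 1).

(* The exponential, for al without component in degree 0. *)
Definition wexp al : ext := \sum_(r < m.+1) (r`!%:R^-1 : K) *: wpow al r.

(* Matrices whose entries are even forms; these commute. *)

Definition wmul X Y : 'M[ext]_m := \matrix_(c, d) \sum_e wedge (X c e) (Y e d).

Definition wmxpow X (r : nat) : 'M[ext]_m :=
  iter r (wmul X) (\matrix_(c, d) ext_const (c == d)%:R).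

Definition wdet X : ext :=
  \sum_(s : 'S_m) ((-1) ^+ (odd_perm s) : K) *:
    \big[wedge/ext_const 1]_c X c (s c).

(* det (X / (1 - exp (- X))), for X nilpotent.  The matrix is the inverse of
   (1 - exp (- X)) / X = sum_l (- X)^l / (l + 1)! = 1 - N, with N nilpotent. *)
Definition todd X : ext :=
  let N := \matrix_(c, d) - \sum_(1 <= l < m.+1)
             ((-1) ^+ l / (l.+1)`!%:R : K) *: wmxpow X l c d in
  wdet (\matrix_(c, d) \sum_(j < m.+1) wmxpow N j c d).

End Exterior.
Arguments ext K m : clear implicits.

Section Liouville.
Context {R : realType} {n : nat} {M : manifold R n.*2}.

(* The coefficient of (2 pi)^-n omega^n / n! on dx_0 /\ ... /\ dx_(2n-1). *)
Definition liouville_coef (w : symplectic_form M) (i : chart M) (x : M) : R :=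
  ((2 * pi) ^+ n)^-1 * (n`!%:R)^-1 * top (wpow (ext2 (omega w i x)) n).

Definition borel (T : ptopologicalType) := g_sigma_algebraType (@open T).

(* The orientation is that of omega^n, so in any chart eps_omega has the
   absolute value of this coefficient as density. *)
Definition is_liouville (w : symplectic_form M)
    (eps : {measure set (borel M) -> \bar R}) : Prop :=
  forall (i : chart M) (B : set (borel M)), measurable B -> B `<=` dom i ->
    eps B = rV_integral (fun p =>
      (\1_(phi i @` B) p * `|liouville_coef w i (psi i p)|)%:E).

Definition cintegral (eps : {measure set (borel M) -> \bar R})
    (f : M -> R[i]) : R[i] :=
  Rintegral eps [set: borel M] ((@complex.Re R) \o f)
  +i* Rintegral eps [set: borel M] ((@complex.Im R) \o f).

(* The integral of the degree 2n part of a form al, given in every chart: with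
   al = f eps_omega in top degree, f does not depend on the chart. *)
Definition form_integral (w : symplectic_form M)
    (eps : {measure set (borel M) -> \bar R})
    (al : chart M -> M -> ext R[i] n.*2) : R[i] :=
  cintegral eps (fun x =>
    let i := chart_at x in top (al i x) / (liouville_coef w i x)%:C).

End Liouville.

Section RiemannRoch.
Context {R : realType} {n : nat} {M : manifold R n.*2}.
Local Notation C := R[i].
Local Notation m := n.*2.

Section Td.
Context {w : symplectic_form M} (J : compatible_acs w).

(* Levi-Civita connection of g: nabla_a v = d_a v + christoffel i a v. *)
Definition christoffel (i : chart M) (a : 'I_m) (x : M) : 'M[R]_m :=
  let g := fun z => metric J i z in
  \matrix_(c, b) (2^-1 * \sum_d invmx (g x) c d *
    (pd i a (fun z => g z b d) x + pd i b (fun z => g z a d) x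
     - pd i d (fun z => g z a b) x)).

(* The connection v |-> (nabla v - J nabla (J v)) / 2, which commutes with J. *)
Definition acs_conn (i : chart M) (a : 'I_m) (x : M) : 'M[R]_m :=
  2^-1 *: (christoffel i a x - acs J i x *m mpd i a (acs J i) x
           - acs J i x *m christoffel i a x *m acs J i x).

Definition acs_curv (i : chart M) (a b : 'I_m) (x : M) : 'M[R]_m :=
  mpd i a (acs_conn i b) x - mpd i b (acs_conn i a) x
  + acs_conn i a x *m acs_conn i b x - acs_conn i b x *m acs_conn i a x.

(* The projection (1 - i J) / 2 of TM_C onto TM^(1,0). *)
Definition proj10 (i : chart M) (x : M) : 'M[C]_m :=
  2^-1 *: (1%:M - 'i *: map_mx (real_complex R) (acs J i x)).

(* By Chern-Weil theory the Todd class of TM^(1,0) is represented by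
   det (X / (1 - exp (- X))), where X is i / 2 pi times the curvature of
   TM^(1,0).  Extending X by 0 to TM^(0,1) does not change the determinant,
   the power series having constant term 1. *)
Definition td_form (i : chart M) (x : M) : ext C m :=
  todd (\matrix_(c, d) ext2 (fun a b => 'i / (2 * pi)%:C *
    (proj10 i x *m map_mx (real_complex R) (acs_curv i a b x)) c d)).

End Td.

(* exp (i F / 2 pi), F the curvature of the k-th tensor power of L. *)
Definition ch_form {L : hermitian_line_bundle M} {w : symplectic_form M}
    (D : prequantum_connection L w) (k : nat) (i : chart M) (x : M) : ext C m :=
  wexp (ext2 (fun a b => 'i / (2 * pi)%:C * (k%:R *
    (cpd i a (fun z => conn D i z b) x - cpd i b (fun z => conn D i z a) x)))).

Definition riemann_roch {L : hermitian_line_bundle M} {w : symplectic_form M}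
    (D : prequantum_connection L w) (J : compatible_acs w)
    (eps : {measure set (borel M) -> \bar R}) (k : nat) : C :=
  form_integral w eps (fun i x => wedge (ch_form D k i x) (td_form J i x)).

End RiemannRoch.

Definition spectral_gap {R : realType} (n k d : nat) (a c : R) (idx : set nat)
    (lam : nat -> R) : Prop :=
  (forall j, (j < d)%N -> idx j /\ - a < lam j < a) /\
  (forall j, (d <= j)%N -> idx j -> (n * k)%:R + c < lam j).

Section Sections.
Context {R : realType} {n : nat} {M : manifold R n.*2}.
Context (L : hermitian_line_bundle M).
Local Notation C := R[i].
Local Notation m := n.*2.

Definition section (k : nat) : Type := forall x : M, tpow (fiber L x) k.

Definition local_coef (k : nat) (i : chart M) (s : section k) (x : M) : C :=
  coef (tpure (frame L i x) k) (s x).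

Definition smooth_section (k : nat) (s : section k) : Prop :=
  forall i, csmooth_on i (dom i) (local_coef i s).

(* h (a q^k) (b q^k) = conj(a) b h(q,q)^k, for any nonzero q. *)
Definition herm_pow (k : nat) (x : M) (u v : tpow (fiber L x) k) : C :=
  let q := vpick {: fiber L x} in
  Num.conj (coef (tpure q k) u) * coef (tpure q k) v * herm q q ^+ k.

Definition inner (eps : {measure set (borel M) -> \bar R}) (k : nat)
    (s1 s2 : section k) : C :=
  cintegral eps (fun x => herm_pow (s1 x) (s2 x)).

Section Laplacian.
Context {w : symplectic_form M} (D : prequantum_connection L w).
Context (J : compatible_acs w).

(* The covariant derivative, on coefficients in the frame e^k. *)
Definition cov (k : nat) (i : chart M) (a : 'I_m) (f : M -> C) (x : M) : C :=
  cpd i a f x + k%:R * conn D i x a * f x.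

(* The (nonnegative) Laplacian nabla^* nabla, in coordinates
   - det(g)^(-1/2) nabla_a (det(g)^(1/2) g^ab nabla_b s). *)
Definition laplacian (k : nat) (s : section k) : section k := fun x =>
  let i := chart_at x in
  let vol := fun z => Num.sqrt (\det (metric J i z)) in
  let flux := fun a z => (vol z)%:C *
    \sum_b (invmx (metric J i z) a b)%:C * cov k i b (local_coef i s) z in
  (- (vol x)^-1%:C * \sum_a cov k i a (flux a) x) *: tpure (frame L i x) k.

Definition rescaled_laplacian (k : nat) (s : section k) : section k := fun x =>
  laplacian s x - ((n * k)%:R : C) *: s x.

(* theta enumerates an orthonormal basis of eigensections, by nondecreasing
   eigenvalue.  The index set idx is all of nat, except that it is finite when
   n = 0, where there are only finitely many linearly independent sections. *)
Record eigenbasis (eps : {measure set (borel M) -> \bar R}) (k : nat)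
    (idx : set nat) (theta : nat -> section k) (lam : nat -> R) : Prop :=
  Eigenbasis {
  eig_index : forall i j, idx j -> (i <= j)%N -> idx i;
  eig_smooth : forall j, idx j -> smooth_section (theta j);
  eig_orthonormal : forall i j, idx i -> idx j ->
    inner eps (theta i) (theta j) = (i == j)%:R;
  eig_eq : forall j, idx j -> forall x,
    rescaled_laplacian (theta j) x = (lam j)%:C *: theta j x;
  eig_mono : forall i j, idx j -> (i <= j)%N -> lam i <= lam j;
  eig_complete : forall s : section k, smooth_section s ->
    (forall j, idx j -> inner eps (theta j) s = 0) -> forall x, s x = 0
}.

End Laplacian.

Section Coherent.
Context (eps : {measure set (borel M) -> \bar R}) {k : nat} (d : nat).
Context (theta : nat -> section k).

Definition quantum_space : set (section k) :=
  [set s | exists c : 'I_d -> C, forall x, s x = \sum_(j < d) c j *: theta j x].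

Definition reproducing_kernel (x y : M) :
    tens (conj_space (tpow (fiber L x) k)) (tpow (fiber L y) k) :=
  \sum_(j < d) tensor (theta j x : conj_space (tpow (fiber L x) k)) (theta j y).

Definition coherent_state (x : M) :
    forall y, tens (conj_space (tpow (fiber L x) k)) (tpow (fiber L y) k) :=
  fun y => reproducing_kernel x y.

(* delta_q s is the number with s x = (delta_q s) q^k. *)
Definition delta (x : M) (q : fiber L x) (s : section k) : C :=
  coef (tpure q k) (s x).

Definition is_rawnsley (x : M) (q : fiber L x) (e : section k) : Prop :=
  quantum_space e /\
  forall s, quantum_space s -> inner eps e s = delta q s.

Definition rawnsley (x : M) (q : fiber L x) : section k :=
  xget ((fun=> 0) : {classic section k}) [set e | is_rawnsley q e].

End Coherent.

End Sections.

(* Main.v *)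
Require Import Defs.
From HB Require Import structures.
From mathcomp Require Import all_boot all_order all_fingroup all_algebra.
From mathcomp Require Import complex.
From mathcomp Require Import all_classical all_reals all_analysis.
From mathcomp Require Import lra measurable_realfun.

Set Implicit Arguments.
Unset Strict Implicit.
Unset Printing Implicit Defensive.

Import Order.TTheory GRing.Theory Num.Theory.
Import numFieldNormedType.Exports.

Local Open Scope classical_set_scope.
Local Open Scope ring_scope.

(** Write [theta_j x = delta_q(theta_j) q^k]; the fibre of the [k]-th tensor
power at [x] is a line spanned by [q^k].  Pulling these scalars through the
tensor product, where the conjugate space conjugates them, turns the kernel
[sum_j conj(theta_j x) (x) theta_j y] into
[conj(q^k) (x) sum_j conj(delta_q(theta_j)) theta_j y].  So the claim is that
the Rawnsley state is [e_q = sum_j conj(delta_q(theta_j)) theta_j]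
([rawnsleyE]), which is the usual formula for the Riesz representative of
[delta_q] in the orthonormal family [theta_0, ..., theta_(d-1)].

The formula needs the inner product to be sesquilinear on the span of the
[theta_j] ([inner_combination]).  As an integral of real and imaginary parts,
it is additive only on integrable integrands, so the functions
[h(theta_i, theta_j)] have to be shown integrable ([cintegrable_herm_pow]).
They are continuous, since the sections and the metric are smooth in the local
frames ([herm_pow_continuous]), hence Borel.  The functions
[h(theta_i, theta_i)] are nonnegative and their integral is 1, not infinite
([integrable_norm2]); the estimate
[|h(u, v)| <= h(u, u) + h(v, v)], applied to the real and imaginary parts of
[h(u, v)], then bounds the mixed terms. *)

(** * Tensor powers of a line *)

Section LinearAlgebra.
Context {R : realType}.
Local Notation C := R[i].
Implicit Types V W : vectType C.

Lemma line_coef V (q v : V) : \dim {: V} = 1%N -> q != 0 -> v = coef q v *: q.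
Proof.
move=> dV q0; have qV : <<[tuple q]>>%VS = fullv.
  rewrite span_seq1; apply/eqP.
  by rewrite eqEdim subvf dV dim_vline q0; exact: leqnn.
have := @coord_span _ _ _ [tuple q] v; rewrite qV memvf => /(_ isT).
by rewrite big_ord1.
Qed.

Lemma coef_linear V (q : V) a u v :
  coef q (a *: u + v) = a * coef q u + coef q v.
Proof. by rewrite /coef linearP. Qed.

Lemma coefZ_id V (q : V) a : q != 0 -> coef q (a *: q) = a.
Proof.
move=> q0; have fq : free [tuple q] by rewrite seq1_free.
by rewrite /coef linearZ /= (coord_free ord0 ord0 fq) eqxx mulr1.
Qed.

Lemma linfunE V W (f : V -> W) : linear f -> linfun f =1 f.
Proof.
move=> lin.
pose F : {linear V -> W} := HB.pack f (GRing.isLinear.Build C V W _ f lin).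
exact: (lfunE F).
Qed.

Lemma tensorE V W (v : V) (w : W) (f : 'Hom(V, C^o)) :
  tensor v w f = (f v : C) *: w.
Proof.
apply: linfunE => a g1 g2.
by rewrite add_lfunE scale_lfunE scalerDl scalerA.
Qed.

Lemma tensorZl V W a (v : V) (w : W) : tensor (a *: v) w = tensor v (a *: w).
Proof.
by apply/lfunP => f; rewrite !tensorE linearZ /= scalerA mulrC.
Qed.

Lemma tensor_sumr V W (v : V) I (r : seq I) (w : I -> W) :
  tensor v (\sum_(i <- r) w i) = \sum_(i <- r) tensor v (w i).
Proof.
apply/lfunP => f; rewrite tensorE sum_lfunE scaler_sumr.
by apply: eq_bigr => i _; rewrite tensorE.
Qed.

Lemma tensor_neq0 V W (v : V) (w : W) : v != 0 -> w != 0 -> tensor v w != 0.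
Proof.
(* Evaluate at a functional taking the value 1 at v. *)
move=> v0 w0; pose f : 'Hom(V, C^o) := linfun (coef v : V -> C^o).
have fv : (f v : C) = 1.
  rewrite linfunE; last by move=> a u1 u2; exact: coef_linear.
  by rewrite -[X in coef _ X](scale1r v) coefZ_id.
apply/eqP => /lfunP/(_ f); rewrite tensorE fv scale1r zero_lfunE => w00.
by rewrite w00 eqxx in w0.
Qed.

Lemma dim_tpow V k : \dim {: V} = 1%N -> \dim {: tpow V k} = 1%N.
Proof.
rewrite !dimvf => dV; elim: k => [|k IH] //=.
have -> : dim (tens V (tpow V k)) = (dim V * 1 * dim (tpow V k))%N by [].
by rewrite dV IH.
Qed.

Lemma tpure_neq0 V (q : V) k : q != 0 -> tpure q k != 0.
Proof.
move=> q0; elim: k => [|k IH] /=; first exact: oner_neq0.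
exact: tensor_neq0.
Qed.

Lemma tpureZ V a (q : V) k : tpure (a *: q) k = a ^+ k *: tpure q k.
Proof.
elim: k => [|k IH] /=; first by rewrite expr0 scale1r.
rewrite IH; apply/lfunP => f; rewrite scale_lfunE !tensorE !scalerA.
have -> : f (a *: q) = a * (f q : C) :> C by rewrite linearZ.
by rewrite exprS mulrAC.
Qed.

Lemma coef_tpureZ V a (q : V) k (u : tpow V k) : \dim {: V} = 1%N ->
  q != 0 -> a != 0 ->
  coef (tpure q k) u = coef (tpure (a *: q) k) u * a ^+ k.
Proof.
move=> dV q0 a0; have aq0 : a *: q != 0 by rewrite scaler_eq0 negb_or a0.
rewrite [in LHS](line_coef u (dim_tpow k dV) (tpure_neq0 k aq0)).
by rewrite [X in coef _ (_ *: X)]tpureZ scalerA coefZ_id // tpure_neq0.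
Qed.

End LinearAlgebra.

(** * The Hermitian metric on tensor powers *)

Section HermitianPower.
Context {R : realType} {n : nat} {M : manifold R n.*2}.
Context {L : hermitian_line_bundle M}.
Local Notation C := R[i].

Lemma hermZZ (x : M) (u : fiber L x) a :
  herm (a *: u) (a *: u) = Num.conj a * a * herm u u.
Proof.
have hZ v b w : herm (v : fiber L x) (b *: w) = b * herm v w.
  have h0 : herm v 0 = 0 :> C.
    apply: (addrI (herm v 0)).
    by rewrite -{1}(mul1r (herm v 0)) -herm_linear scale1r !addr0.
  by rewrite -[b *: w]addr0 herm_linear h0 addr0.
by rewrite hZ (herm_sym (a *: u) u) hZ rmorphM /= -herm_sym mulrA (mulrC a).
Qed.

Lemma herm_real (x : M) (e : fiber L x) : e != 0 ->
  exists2 r : R, 0 <= r & herm e e = (r%:C)%C.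
Proof.
move=> /herm_pos; rewrite ltcE /= => /andP[/eqP h0 hpos].
exists (complex.Re (herm e e)); first exact: ltW.
by case: (herm e e) h0 => ? ? /= ->.
Qed.

(** The metric on tensor powers is defined with a basis vector chosen anew in
every fibre, which has no continuity in the base point.  Since every basis
vector gives the same value, a smooth frame can be used instead. *)
Lemma herm_powE k (x : M) (e : fiber L x) (u v : tpow (fiber L x) k) :
  e != 0 ->
  herm_pow u v =
  Num.conj (coef (tpure e k) u) * coef (tpure e k) v * herm e e ^+ k.
Proof.
move=> e0; rewrite /herm_pow; set q := vpick _.
have dV := fiber_dim L x.
have q0 : q != 0 by rewrite vpick0 -dimv_eq0 dV.
have eq := line_coef e dV q0; set a := coef q e in eq.
have a0 : a != 0 by apply: contraNneq e0 => a0; rewrite eq a0 scale0r.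
rewrite !(coef_tpureZ _ dV q0 a0) -eq [in RHS]eq hermZZ exprMn exprMn.
rewrite !rmorphM rmorphXn /= -eq !mulrA; congr (_ * _).
by rewrite -!mulrA; congr (_ * _); rewrite mulrCA.
Qed.

Lemma herm_pow_linear k (x : M) (u : tpow (fiber L x) k) a v w :
  herm_pow u (a *: v + w) = a * herm_pow u v + herm_pow u w.
Proof.
by rewrite /herm_pow coef_linear mulrDr mulrDl !mulrA [_ * a]mulrC.
Qed.

Lemma herm_pow_sym k (x : M) (u v : tpow (fiber L x) k) :
  herm_pow u v = Num.conj (herm_pow v u).
Proof.
rewrite /herm_pow !rmorphM /= conjCK rmorphXn /= -herm_sym.
by rewrite [X in X * _ = _]mulrC.
Qed.

Lemma herm_pow_sumr k (x : M) (u : tpow (fiber L x) k) I (r : seq I)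
    (c : I -> C) (t : I -> tpow (fiber L x) k) :
  herm_pow u (\sum_(j <- r) c j *: t j) = \sum_(j <- r) c j * herm_pow u (t j).
Proof.
elim: r => [|j r IH]; last by rewrite !big_cons herm_pow_linear IH.
by rewrite !big_nil /herm_pow /coef linear0 mulr0 mul0r.
Qed.

Lemma herm_pow_sum k (x : M) (I : finType) (b c : I -> C)
    (t : I -> tpow (fiber L x) k) :
  herm_pow (\sum_j b j *: t j) (\sum_j c j *: t j) =
  \sum_(p : I * I) Num.conj (b p.1) * c p.2 * herm_pow (t p.1) (t p.2).
Proof.
rewrite -(pair_bigA _
  (fun i j => Num.conj (b i) * c j * herm_pow (t i) (t j))) /=.
rewrite herm_pow_sumr exchange_big; apply: eq_bigr => j _ /=.
rewrite herm_pow_sym herm_pow_sumr rmorph_sum mulr_sumr.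
by apply: eq_bigr => i _; rewrite rmorphM /= -herm_pow_sym mulrCA mulrA.
Qed.

Lemma herm_pow_ge0 k (x : M) (u : tpow (fiber L x) k) :
  0 <= complex.Re (herm_pow u u).
Proof.
have e0 := frame_neq0 L (chart_atP x); set e := frame _ _ _ in e0.
rewrite (herm_powE _ _ e0); have [r r0 ->] := herm_real e0.
rewrite -rmorphXn /=; case: (coef _ u) => a1 a2 /=.
rewrite !mulr0 !(mulNr, subr0, opprK) -!expr2.
by rewrite mulr_ge0 ?exprn_ge0 // addr_ge0 ?sqr_ge0.
Qed.

(** The inequality between arithmetic and geometric means replaces that of
Cauchy and Schwarz: a bound by a sum of two integrable functions is what
dominates the mixed terms. *)
Lemma herm_pow_bound k (x : M) (u v : tpow (fiber L x) k) :
  let b := complex.Re (herm_pow u u) + complex.Re (herm_pow v v) in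
  `|complex.Re (herm_pow u v)| <= b /\ `|complex.Im (herm_pow u v)| <= b.
Proof.
have e0 := frame_neq0 L (chart_atP x); set e := frame _ _ _ in e0.
rewrite /= !(herm_powE _ _ e0); have [r r0 ->] := herm_real e0.
rewrite -rmorphXn /=; have : 0 <= r ^+ k by exact: exprn_ge0.
move: (r ^+ k) => {r r0} {}r r0.
case: (coef _ u) (coef _ v) => a1 a2 [b1 b2] /=.
rewrite !mulr0 !(mulNr, subr0, addr0, add0r, opprK) !ler_norml.
have sq (y : R) : 0 <= y * y * r by rewrite mulr_ge0 // -expr2 sqr_ge0.
have := (sq a1, sq a2, sq b1, sq b2).
have := (sq (a1 + b1), sq (a2 + b2), sq (a1 - b1), sq (a2 - b2)).
have := (sq (a1 + b2), sq (a2 - b1), sq (a1 - b2), sq (a2 + b1)).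
move=> [[[? ?] ?] ?] [[[? ?] ?] ?] [[[? ?] ?] ?].
by split; apply/andP; split; lra.
Qed.

Lemma smooth_on_continuous (i : chart M) (U : set M) (f : M -> R) x :
  open U -> U `<=` Defs.dom i -> U x -> smooth_on i U f ->
  {for x, continuous f}.
Proof.
move=> oU Ui Ux sf.
have cx : {for x, continuous ((f \o psi i) \o phi i)}.
  apply: continuous_comp; first exact: phi_continuous (Ui _ Ux).
  by have [cf _] := sf 0%N; apply: cf; exists x.
have E : \forall z \near x, ((f \o psi i) \o phi i) z = f z.
  near=> z; rewrite /= phiK //; apply: Ui.
  by near: z; exact: open_nbhs_nbhs.
rewrite /prop_for /continuous_at.
have <- : ((f \o psi i) \o phi i) x = f x by rewrite /= phiK //; exact: Ui.
exact: cvg_trans (near_eq_cvg E) cx.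
Unshelve. all: by end_near. Qed.

Lemma herm_pow_continuous k (s t : section L k) :
  smooth_section s -> smooth_section t ->
  continuous ((@complex.Re R) \o (fun x => herm_pow (s x) (t x))) /\
  continuous ((@complex.Im R) \o (fun x => herm_pow (s x) (t x))).
Proof.
move=> ss st; set f := fun x => herm_pow (s x) (t x).
suff H x : {for x, continuous ((@complex.Re R) \o f)} /\
    {for x, continuous ((@complex.Im R) \o f)}.
  by split=> x; case: (H x).
pose i := chart_at x; have ix : Defs.dom i x := chart_atP x.
have oi : open (Defs.dom i) by exact: dom_open.
have cts g : csmooth_on i (Defs.dom i) g ->
    {for x, continuous ((@complex.Re R) \o g)} /\
    {for x, continuous ((@complex.Im R) \o g)}.
  by move=> [g1 g2]; split;
    apply: (smooth_on_continuous (i := i) (U := Defs.dom i)).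
have [s1 s2] := cts _ (ss i); have [t1 t2] := cts _ (st i).
have [h1 _] := cts _ (herm_smooth L i).
pose h z := complex.Re (herm (frame L i z) (frame L i z)).
have hk : {for x, continuous (fun z => h z ^+ k)}.
  apply: (@continuous_comp _ _ _ h (fun r : R => r ^+ k)) => //.
  exact: exprn_continuous.
pose a1 z := complex.Re (local_coef i s z).
pose a2 z := complex.Im (local_coef i s z).
pose b1 z := complex.Re (local_coef i t z).
pose b2 z := complex.Im (local_coef i t z).
have E z : Defs.dom i z -> f z =
    ((a1 z * b1 z + a2 z * b2 z) * h z ^+ k +i*
     ((a1 z * b2 z - a2 z * b1 z) * h z ^+ k))%C.
  move=> iz; have e0 := frame_neq0 L iz; rewrite /f (herm_powE _ _ e0).
  rewrite /a1 /a2 /b1 /b2 /h /local_coef; have [r _ ->] := herm_real e0.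
  rewrite -rmorphXn /=; case: (coef _ _) (coef _ _) => ? ? [? ?].
  apply/eqP; rewrite eq_complex /= !mulr0.
  by rewrite !(mulNr, subr0, addr0, add0r, opprK) /= eqxx addrC eqxx.
have near_dom : \forall z \near x, Defs.dom i z by exact: open_nbhs_nbhs.
split; rewrite /prop_for /continuous_at /= (E _ ix) /=.
- apply: cvg_trans
    (_ : (a1 z * b1 z + a2 z * b2 z) * h z ^+ k @[z --> x] --> _).
    by apply: near_eq_cvg; apply: filterS near_dom => z /E Ez; rewrite /= Ez.
  by apply: cvgM hk; apply: cvgD; exact: cvgM.
- apply: cvg_trans
    (_ : (a1 z * b2 z - a2 z * b1 z) * h z ^+ k @[z --> x] --> _).
    by apply: near_eq_cvg; apply: filterS near_dom => z /E Ez; rewrite /= Ez.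
  by apply: cvgM hk; apply: cvgB; exact: cvgM.
Qed.

End HermitianPower.

(** * Integration of complex functions *)

Section ComplexIntegral.
Context {R : realType} {n : nat} {M : manifold R n.*2}.
Context (eps : {measure set (borel M) -> \bar R}).
Local Notation C := R[i].

Definition cintegrable (f : M -> C) : Prop :=
  eps.-integrable [set: borel M] (EFin \o ((@complex.Re R) \o f)) /\
  eps.-integrable [set: borel M] (EFin \o ((@complex.Im R) \o f)).

Lemma cintegrable0 : cintegrable (fun=> 0).
Proof. by split; exact: integrable0. Qed.

Lemma cintegrableD f g : cintegrable f -> cintegrable g ->
  cintegrable (fun x => f x + g x).
Proof.
move=> [f1 f2] [g1 g2]; split.
- apply: eq_integrable (integrableD measurableT f1 g1) => // x _ /=.
  by case: (f x) (g x) => ? ? [? ?].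
- apply: eq_integrable (integrableD measurableT f2 g2) => // x _ /=.
  by case: (f x) (g x) => ? ? [? ?].
Qed.

Lemma cintegrableZ a f : cintegrable f -> cintegrable (fun x => a * f x).
Proof.
move: a => [a1 a2] [f1 f2]; split.
- apply: eq_integrable (integrableD measurableT (integrableZl measurableT a1 f1)
    (integrableZl measurableT (- a2) f2)) => // x _ /=.
  by case: (f x) => ? ? /=; rewrite -!EFinM -EFinD mulNr.
- apply: eq_integrable (integrableD measurableT (integrableZl measurableT a1 f2)
    (integrableZl measurableT a2 f1)) => // x _ /=.
  by case: (f x) => ? ? /=; rewrite -!EFinM -EFinD.
Qed.

Lemma cintegralD f g : cintegrable f -> cintegrable g ->
  cintegral eps (fun x => f x + g x) = cintegral eps f + cintegral eps g.
Proof.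
move=> [f1 f2] [g1 g2]; rewrite /cintegral.
apply/eqP; rewrite eq_complex /=.
rewrite -!(RintegralD measurableT) //; apply/andP; split; apply/eqP;
  by apply: eq_Rintegral => x _ /=; case: (f x) (g x) => ? ? [? ?].
Qed.

Lemma cintegralZ a f : cintegrable f ->
  cintegral eps (fun x => a * f x) = a * cintegral eps f.
Proof.
move: a => [a1 a2] [f1 f2]; rewrite /cintegral.
apply/eqP; rewrite eq_complex /= -!mulNr -!(RintegralZl _ measurableT) //.
have Z b g : eps.-integrable setT (EFin \o g) ->
    eps.-integrable setT (EFin \o (fun x => b * g x)).
  by move=> /(integrableZl measurableT b).
rewrite -!(RintegralD measurableT) //; do 1?[exact: Z].
apply/andP; split; apply/eqP; apply: eq_Rintegral => x _ /=;
  by case: (f x) => ? ? /=; rewrite ?mulNr.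
Qed.

Lemma cintegral_sum I (r : seq I) (a : I -> C) (f : I -> M -> C) :
  (forall i, cintegrable (f i)) ->
  cintegral eps (fun x => \sum_(i <- r) a i * f i x) =
  \sum_(i <- r) a i * cintegral eps (f i).
Proof.
move=> fi.
have si r' : cintegrable (fun x => \sum_(i <- r') a i * f i x).
  elim: r' => [|i r' IH].
    by under eq_fun do rewrite big_nil; exact: cintegrable0.
  under eq_fun do rewrite big_cons.
  by apply: cintegrableD => //; exact: cintegrableZ.
elim: r => [|i r IH].
  rewrite big_nil -[RHS](mul0r (cintegral eps (fun=> 0))) -cintegralZ.
    by under eq_fun do rewrite big_nil -(mul0r 0).
  exact: cintegrable0.
under eq_fun do rewrite big_cons.
by rewrite big_cons cintegralD // ?cintegralZ ?IH //; exact: cintegrableZ.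
Qed.

End ComplexIntegral.

(** * Integrability of products of normalized sections *)

Lemma continuous_borel (R : realType) (T : ptopologicalType) (f : T -> R) :
  continuous f -> measurable_fun [set: borel T] (f : borel T -> R).
Proof.
move=> /continuousP cf.
apply: (measurability _ (RGenOpens.measurableE R)).
move=> /= _ [_ [a [b ->]] <-]; apply: measurableI => //.
by apply: sub_sigma_algebra; exact/cf/interval_open.
Qed.

Section Integrability.
Context {R : realType} {n : nat} {M : manifold R n.*2}.
Context {L : hermitian_line_bundle M}.
Context (eps : {measure set (borel M) -> \bar R}).

(** The real integral of a function with infinite integral is 0 by convention;
having the value 1, it is therefore that of an integrable function. *)
Lemma integrable_norm2 k (s : section L k) : smooth_section s ->
  inner eps s s = 1 ->
  eps.-integrable [set: borel M]
    (EFin \o ((@complex.Re R) \o (fun x => herm_pow (s x) (s x)))).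
Proof.
move=> ss; set f : borel M -> R := (@complex.Re R) \o _.
move=> /(congr1 (@complex.Re R)) /=; rewrite -/f => If.
have mf : measurable_fun [set: borel M] (EFin \o f).
  apply/measurable_EFinP; apply: continuous_borel.
  by have [] := herm_pow_continuous ss ss.
apply/integrableP; split => //.
have -> : (\int[eps]_(x in [set: borel M]) `|(EFin \o f) x| =
           \int[eps]_(x in [set: borel M]) (EFin \o f) x)%E.
  by apply: eq_integral => x _ /=; rewrite ger0_norm //; exact: herm_pow_ge0.
rewrite ltNge leye_eq; apply/eqP => I.
by move: If; rewrite /Rintegral I /= => /eqP; rewrite eq_sym oner_eq0.
Qed.

Lemma cintegrable_herm_pow k (s t : section L k) :
  smooth_section s -> smooth_section t ->
  inner eps s s = 1 -> inner eps t t = 1 ->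
  cintegrable eps (fun x => herm_pow (s x) (t x)).
Proof.
move=> ss st Is It; have [c1 c2] := herm_pow_continuous ss st.
have dom_int := integrableD measurableT
  (integrable_norm2 ss Is) (integrable_norm2 st It).
have dominated (f : borel M -> R) : continuous (f : M -> R) ->
    (forall x, `|f x| <= complex.Re (herm_pow (s x) (s x)) +
                         complex.Re (herm_pow (t x) (t x))) ->
    eps.-integrable [set: borel M] (EFin \o f).
  move=> cf fle; apply: le_integrable dom_int => //.
    by apply/measurable_EFinP; exact: continuous_borel.
  by move=> x _ /=; rewrite lee_fin; apply: le_trans (fle x) (ler_norm _).
by split; apply: dominated => // x; have [] := herm_pow_bound (s x) (t x).
Qed.

End Integrability.

(** * Coherent states in an orthonormal family *)

Section CoherentStates.
Context {R : realType} {n : nat} {M : manifold R n.*2}.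
Context {L : hermitian_line_bundle M}.
Context (eps : {measure set (borel M) -> \bar R}).
Context (k d : nat) (theta : nat -> section L k).
Local Notation C := R[i].
Context (theta_smooth : forall j, (j < d)%N -> smooth_section (theta j)).
Context (theta_orthonormal : forall i j, (i < d)%N -> (j < d)%N ->
  inner eps (theta i) (theta j) = (i == j)%:R).

Definition combination (c : 'I_d -> C) : section L k :=
  fun x => \sum_(j < d) c j *: theta j x.

Lemma inner_combination b c :
  inner eps (combination b) (combination c) = \sum_j Num.conj (b j) * c j.
Proof.
rewrite /inner /combination.
under eq_fun do rewrite herm_pow_sum.
rewrite (cintegral_sum _ (fun p => Num.conj (b p.1) * c p.2)
  (f := fun p x => herm_pow (theta p.1 x) (theta p.2 x))); last first.
  move=> p; apply: cintegrable_herm_pow; do ?[exact: theta_smooth];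
    by rewrite theta_orthonormal ?eqxx.
rewrite -(pair_bigA _ (fun i j =>
  Num.conj (b i) * c j * inner eps (theta i) (theta j))) /=.
apply: eq_bigr => i _; rewrite (bigD1 i) //= big1 ?addr0 => [|j ji].
  by rewrite theta_orthonormal // eqxx mulr1.
by rewrite theta_orthonormal // eq_sym [_ == _](negbTE ji) mulr0.
Qed.

Lemma delta_combination (x : M) (q : fiber L x) c :
  delta q (combination c) = \sum_j c j * delta q (theta j).
Proof.
rewrite /delta /combination /coef linear_sum /=; apply: eq_bigr => j _.
by rewrite linearZ.
Qed.

(** The inner product is conjugate linear in its first argument, whence the
conjugated coefficients.  Pairing a representative with the [theta_j] recovers
its coefficients, so there is only one. *)
Lemma rawnsleyE (x : M) (q : fiber L x) :
  rawnsley eps d theta q = combination (fun j => Num.conj (delta q (theta j))).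
Proof.
set e := combination _.
apply: xget_unique => [|e' [[b eb] He']].
  split; first by exists (fun j : 'I_d => Num.conj (delta q (theta j))).
  move=> s [c sc].
  have -> : s = combination c by exact: functional_extensionality_dep.
  rewrite inner_combination delta_combination; apply: eq_bigr => j _.
  by rewrite conjCK mulrC.
have E : e' = combination b by exact: functional_extensionality_dep.
rewrite E; congr combination; apply/funext => j.
pose c (i : 'I_d) : C := (i == j)%:R.
have pick (f : 'I_d -> C) : \sum_i f i * c i = f j.
  rewrite (bigD1 j) //= big1 => [|i /negbTE ij]; last by rewrite /c ij mulr0.
  by rewrite /c eqxx mulr1 addr0.
have /He' : quantum_space d theta (combination c) by exists c.
rewrite E inner_combination pick delta_combination.
under eq_bigr do rewrite mulrC; rewrite pick => <-; exact/esym/conjCK.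
Qed.

Lemma reproducing_kernelE (x y : M) (q : fiber L x) : q != 0 ->
  reproducing_kernel d theta x y =
  tensor (tpure q k : conj_space (tpow (fiber L x) k))
         (rawnsley eps d theta q y).
Proof.
move=> q0; rewrite rawnsleyE /combination tensor_sumr; apply: eq_bigr => j _.
rewrite -tensorZl; congr (tensor _ _).
rewrite [LHS](line_coef _ (dim_tpow k (fiber_dim L x)) (tpure_neq0 k q0)).
(* Scaling in the conjugate space conjugates the coefficient once more. *)
by rewrite -[RHS]/(Num.conj (Num.conj (delta q (theta j))) *: _) conjCK.
Qed.

End CoherentStates.

Theorem theorem3p11 (R : realType) (n : nat) (M : manifold R n.*2)
  (w : symplectic_form M) (L : hermitian_line_bundle M)
  (D : prequantum_connection L w) (J : compatible_acs w)
  (eps : {measure set (borel M) -> \bar R}) (heps : is_liouville w eps)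
  (a c : R) (ha : 0 < a)
  (k d : nat) (hd : d%:R = riemann_roch D J eps k)
  (idx : set nat) (theta : nat -> section L k) (lam : nat -> R)
  (htheta : eigenbasis D J eps idx theta lam)
  (hgap : spectral_gap n k d a c idx lam)
  (x : M) (q : fiber L x) (hq : q != 0) :
  (forall y : M,
     reproducing_kernel d theta x y =
     tensor (tpure q k : conj_space (tpow (fiber L x) k))
            (rawnsley eps d theta q y)) /\
  coherent_state d theta x =
    (fun y => tensor (tpure q k : conj_space (tpow (fiber L x) k))
                     (rawnsley eps d theta q y)).
Proof.
have idx_lt j : (j < d)%N -> idx j by move=> jd; have [] := hgap.1 j jd.
have K y : reproducing_kernel d theta x y =
    tensor (tpure q k : conj_space (tpow (fiber L x) k))
           (rawnsley eps d theta q y).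
  apply: reproducing_kernelE hq => [j /idx_lt|i j /idx_lt ii /idx_lt ij].
    exact: eig_smooth htheta _.
  exact: eig_orthonormal htheta _ _ ii ij.
by split=> //; apply: functional_extensionality_dep => y; exact: K.
Qed.
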